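(* Let $X$ be a Lindelöf space which is locally null with respect to a $\sigma$-ideal $\mathscr{I}$ of an upper semi-lattice $(\mathscr{L},\subseteq)$, where $\mathscr{L}\subseteq\mathscr{P}(X)$. Let $\mathscr{RC}(X)\subseteq\mathscr{L}$. Then \[C^{\mathscr I}_{00}(X)=\big\{f\in C_b(X):\mathrm{supp}(f)\text{ is null}\big\}.\]
   Context: A space is a topological space and $\mathscr{P}(X)$ is the power set of $X$. $C_b(X)$ is the algebra of continuous bounded $f:X\to\mathbb{R}$; $\mathrm{coz}(f)=X\setminus f^{-1}(0)$ and $\mathrm{supp}(f)=\mathrm{cl}_X\mathrm{coz}(f)$. $\mathscr{RC}(X)$ is the set of all regular closed subspaces of $X$, i.e. sets $A\subseteq X$ with $A=\mathrm{cl}_X\mathrm{int}_XA$. An upper semi-lattice is a partially ordered set in which any two elements $A,B$ have a least upper bound $A\vee B$. For $\mathscr{L}\subseteq\mathscr{P}(X)$ ordered by inclusion, least upper bounds are computed in $\mathscr{L}$ and need not be unions. An ideal $\mathscr{I}$ in $(\mathscr{L},\subseteq)$ is a non-empty subset of $\mathscr{L}$ such that $A\vee B\in\mathscr{I}$ whenever $A,B\in\mathscr{I}$, and $T\in\mathscr{I}$ whenever $T\in\mathscr{L}$ and $T\subseteq A$ for some $A\in\mathscr{I}$. When $\mathscr{L}$ contains least upper bounds of all its countable subsets (this is part of the assumption whenever $\sigma$-ideals are mentioned), $\mathscr{I}$ is a $\sigma$-ideal if moreover $\bigvee\mathscr{J}\in\mathscr{I}$ for every countable $\mathscr{J}\subseteq\mathscr{I}$.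 Elements of $\mathscr{I}$ are called null. A neighborhood of a set $A$ in $X$ is a set $U\subseteq X$ with $A\subseteq\mathrm{int}_XU$. $X$ is locally null (with respect to $\mathscr{I}$) if every point of $X$ has a null neighborhood in $X$. $C^{\mathscr I}_{00}(X)=\{f\in C_b(X):\mathrm{supp}(f)\text{ has a null neighborhood in }X\}$. *)

(* Defs.v *)
From mathcomp Require Import all_boot all_order all_algebra.
From mathcomp Require Import all_classical all_reals all_analysis.

Set Implicit Arguments.
Unset Strict Implicit.
Unset Printing Implicit Defensive.

Import Order.TTheory GRing.Theory Num.Theory numFieldNormedType.Exports.

Local Open Scope classical_set_scope.
Local Open Scope ring_scope.

Section SetLattices.
Variable X : Type.
Implicit Types (L I J : set (set X)) (A B S : set X).

(* [S] is the least upper bound of [J] computed in the poset (L, `<=`); it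
   contains, but need not equal, the union of [J]. *)
Definition is_join L J S :=
  [/\ L S,
      forall A, J A -> A `<=` S
    & forall B, L B -> (forall A, J A -> A `<=` B) -> S `<=` B].

Definition upper_semilattice L :=
  forall A B, L A -> L B -> exists S, is_join L [set A; B] S.

(* [countable] includes finite and empty subsets. *)
Definition has_countable_joins L :=
  forall J, J `<=` L -> countable J -> exists S, is_join L J S.

(* Joins are unique when they exist, so closure under joins is stated by
   quantifying over all [S] with [is_join L J S]. *)
Definition ideal L I :=
  [/\ I `<=` L,
      I !=set0,
      forall A B S, I A -> I B -> is_join L [set A; B] S -> I S
    & forall A S, I A -> L S -> S `<=` A -> I S].

Definition sigma_ideal L I :=
  [/\ has_countable_joins L,
      ideal L I
    & forall J S, J `<=` I -> countable J -> is_join L J S -> I S].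

End SetLattices.

(* No separation axiom is included. *)
Definition lindelof (X : topologicalType) :=
  forall C : set (set X),
    C `<=` open -> \bigcup_(U in C) U = [set: X] ->
    exists D : set (set X),
      [/\ D `<=` C, countable D & \bigcup_(U in D) U = [set: X]].

Definition locally_null (X : topologicalType) (I : set (set X)) :=
  forall x : X, exists2 U, nbhs x U & I U.

Section BoundedContinuous.
Variables (R : realType) (X : topologicalType).

Definition Cb : set (X -> R) := [set f | continuous f /\ bounded_fun f].

Definition coz (f : X -> R) : set X := ~` (f @^-1` [set 0]).

Definition supp (f : X -> R) : set X := closure (coz f).

(* [set_nbhs A U] unfolds to [forall x, A x -> nbhs x U], i.e. A `<=` U°. *)
Definition C00 (I : set (set X)) : set (X -> R) :=
  [set f | Cb f /\ exists2 U, set_nbhs (supp f) U & I U].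

End BoundedContinuous.

(* Main.v *)
Require Import Defs.
From mathcomp Require Import all_boot all_order all_algebra.
From mathcomp Require Import all_classical all_reals all_analysis.

Import numFieldNormedType.Exports.

(** The hypotheses force the whole space to be null: countably many null
    neighborhoods cover a Lindelöf space, and their join in the lattice, being
    an upper bound of a cover, is the whole space
    ([lindelof_locally_null_setT]). So the space itself is a null neighborhood
    of every support. Conversely, the support of a continuous function is the
    closure of an open set, hence regular closed ([regclosed_supp]), hence an
    element of the lattice; if it has a null neighborhood, it is null because
    ideals are downward closed within the lattice. *)

Local Open Scope classical_set_scope.
Local Open Scope ring_scope.

(** The neighborhoods are not assumed open, so the covering property is applied
    to the open sets inside members of [B], and each open set of the countable
    subcover is then enlarged to a member of [B]. *)
Lemma lindelof_countable_nbhs_cover {X : topologicalType} {B : set (set X)} :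
    lindelof X -> (forall x : X, exists2 U, nbhs x U & B U) ->
  exists J : set (set X),
    [/\ J `<=` B, countable J & \bigcup_(U in J) U = [set: X]].
Proof.
move=> hX hB.
have [||D [DC cD Dcov]] :=
  hX [set V | open V /\ exists2 U, B U & V `<=` U].
- by move=> V [].
- apply/seteqP; split=> // x _; have [U xU BU] := hB x.
  exists (U°)%classic => //; split; first exact: open_interior.
  by exists U => //; exact: interior_subset.
have /choice[g gP] : forall V, exists U, D V -> B U /\ V `<=` U.
  move=> V; have [DV|nDV] := pselect (D V); last by exists V.
  by have [_ [U BU VU]] := DC V DV; exists U.
exists (g @` D); split.
- by move=> _ [V /gP[BgV _] <-].
- exact: sub_countable (card_image_le g D) cD.
- apply/seteqP; split=> // x _.
  have [V DV Vx] : (\bigcup_(U in D) U) x by rewrite Dcov.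
  by exists (g V); [exists V | exact: (gP V DV).2].
Qed.

Lemma lindelof_locally_null_setT {X : topologicalType} {L I : set (set X)} :
  lindelof X -> sigma_ideal L I -> locally_null I -> I [set: X].
Proof.
move=> hX [joinsL [IL _ _ _] joinsI] hnull.
have [J [JI cJ Jcov]] := lindelof_countable_nbhs_cover hX hnull.
have [S SJ] := joinsL J (subset_trans JI IL) cJ.
suff <- : S = [set: X] by exact: joinsI SJ.
have [_ ubS _] := SJ.
by apply/seteqP; split=> //; rewrite -Jcov => x [U JU Ux]; exact: ubS Ux.
Qed.

Lemma regclosed_supp {R : realType} {X : topologicalType} {f : X -> R} :
  continuous f -> regclosed (supp f).
Proof.
move=> cf; apply: closure_open_regclosed; rewrite /coz openC.
by apply: closed_comp => [x _|]; [exact: cf | exact: closed_eq].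
Qed.

Theorem theorem2p16 (R : realType) (X : topologicalType)
    (L I : set (set X))
    (hX : lindelof X)
    (hL : upper_semilattice L)
    (hI : sigma_ideal L I)
    (hnull : locally_null I)
    (hRC : @regclosed X `<=` L) :
  @C00 R X I = [set f : X -> R | Cb f /\ I (supp f)].
Proof.
apply/seteqP; split=> f /= [Cbf].
- move=> [U sU IU]; split=> //.
  have [_ [_ _ _ downI] _] := hI.
  apply: (downI U) => //; first by apply/hRC/regclosed_supp; case: Cbf.
  by move=> x /sU; exact: nbhs_singleton.
- move=> _; split=> //; exists [set: X].
    by move=> x _; exact: filterT.
  exact: lindelof_locally_null_setT hX hI hnull.
Qed.
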